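(* Let $\mathcal{X}$ be a finite nonempty set. The space $(\mathrm{DMC}_{\mathcal{X},\ast}^{(o)},\mathcal{T}_{s,\mathcal{X},\ast}^{(o)})$, where $\mathcal{T}_{s,\mathcal{X},\ast}^{(o)}$ is the strong topology, is compactly generated, sequential and $T_4$.
   Context: For finite nonempty sets $\mathcal{X},\mathcal{Y}$, $\mathrm{DMC}_{\mathcal{X},\mathcal{Y}}$ is the set of channels from $\mathcal{X}$ to $\mathcal{Y}$, i.e. functions $W:\mathcal{X}\times\mathcal{Y}\to[0,1]$, written $W(y|x)$, with $\sum_{y\in\mathcal{Y}}W(y|x)=1$ for every $x\in\mathcal{X}$. It carries the topology $\mathcal{T}_{\mathcal{X},\mathcal{Y}}$ inherited from the Euclidean topology of $\mathbb{R}^{\mathcal{X}\times\mathcal{Y}}$. For $W\in\mathrm{DMC}_{\mathcal{X},\mathcal{Y}}$ and $V\in\mathrm{DMC}_{\mathcal{Y},\mathcal{Z}}$, the composition $V\circ W\in\mathrm{DMC}_{\mathcal{X},\mathcal{Z}}$ is $(V\circ W)(z|x)=\sum_{y\in\mathcal{Y}}V(z|y)W(y|x)$. A channel $W'\in\mathrm{DMC}_{\mathcal{X},\mathcal{Z}}$ is degraded from $W\in\mathrm{DMC}_{\mathcal{X},\mathcal{Y}}$ if $W'=V\circ W$ for some $V\in\mathrm{DMC}_{\mathcal{Y},\mathcal{Z}}$; $W$ and $W'$ are equivalent if each is degraded from the other. Let $[n]=\{1,\dots,n\}$, let $\mathrm{DMC}_{\mathcal{X},\ast}=\coprod_{n\ge1}\mathrm{DMC}_{\mathcal{X},[n]}$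 with the disjoint union topology $\bigoplus_{n\ge1}\mathcal{T}_{\mathcal{X},[n]}$, and let $\mathrm{DMC}_{\mathcal{X},\ast}^{(o)}$ be the quotient of $\mathrm{DMC}_{\mathcal{X},\ast}$ by equivalence of channels. The strong topology $\mathcal{T}_{s,\mathcal{X},\ast}^{(o)}$ is the quotient topology on $\mathrm{DMC}_{\mathcal{X},\ast}^{(o)}$. A space is compactly generated if it is Hausdorff and a subset $F$ is closed if and only if $F\cap K$ is closed for every compact subset $K$. A subset $U$ is sequentially open if every sequence converging to a point of $U$ lies eventually in $U$; a space is sequential if every sequentially open subset is open. $T_4$ means $T_1$ and normal. *)

(* Defs.v *)
From HB Require Import structures.
From mathcomp Require Import all_boot all_order all_algebra.
From mathcomp Require Import generic_quotient.
From mathcomp Require Import all_classical all_reals topology normedtype.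

Set Implicit Arguments.
Unset Strict Implicit.
Unset Printing Implicit Defensive.

Import Order.TTheory GRing.Theory Num.Theory.
Import numFieldNormedType.Exports.

Local Open Scope classical_set_scope.
Local Open Scope ring_scope.
Local Open Scope quotient_scope.

Section channels.
Context {R : realType}.

(* [W (x, y)] is the transition probability W(y|x). *)
Definition is_channel (X Y : finType) (W : X * Y -> R) : Prop :=
  (forall x y, 0 <= W (x, y) <= 1) /\ (forall x, \sum_y W (x, y) = 1).

(* The topology on the finite product R^(X * Y) is the topology of pointwise
   convergence, i.e. the product topology, which is the Euclidean one; [DMC]
   gets the subspace topology, as the [set_type] of a set. *)
Definition DMC (X Y : finType) : Type :=
  [set W : {ptws (X * Y)%type -> R} | is_channel W].

HB.instance Definition _ (X Y : finType) := Topological.copy (DMC X Y)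
  [set W : {ptws (X * Y)%type -> R} | is_channel W].

Definition channel_fun (X Y : finType) (W : DMC X Y) : X * Y -> R := \val W.
Coercion channel_fun : DMC >-> Funclass.

Lemma channelP (X Y : finType) (W : DMC X Y) : is_channel W.
Proof. exact: set_valP W. Qed.

Lemma channel_ext (X Y : finType) (W W' : DMC X Y) :
  (forall x y, W (x, y) = W' (x, y)) -> W = W'.
Proof. by move=> h; apply/val_inj/funext => -[x y]; exact: h. Qed.

Definition mk_channel (X Y : finType) (W : X * Y -> R) (hW : is_channel W) :
  DMC X Y := SigSub (mem_set hW).

Definition comp_fun (X Y Z : finType) (V : DMC Y Z) (W : DMC X Y)
  (xz : X * Z) : R := \sum_y V (y, xz.2) * W (xz.1, y).

Lemma is_channel_comp (X Y Z : finType) (V : DMC Y Z) (W : DMC X Y) :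
  is_channel (comp_fun V W).
Proof.
have [Vb V1] := channelP V; have [Wb W1] := channelP W.
split=> [x z|x]; rewrite /comp_fun /=.
  apply/andP; split.
    by apply: sumr_ge0 => y _; apply: mulr_ge0; [case/andP: (Vb y z)|
      case/andP: (Wb x y)].
  rewrite -(W1 x); apply: ler_sum => y _.
  by case/andP: (Vb y z) => _ ?; case/andP: (Wb x y) => ? _; rewrite ler_piMl.
rewrite exchange_big /= -(W1 x); apply: eq_bigr => y _.
by rewrite -mulr_suml V1 mul1r.
Qed.

Definition comp_channel (X Y Z : finType) (V : DMC Y Z) (W : DMC X Y) :
  DMC X Z := mk_channel (is_channel_comp V W).

Definition degraded (X Y Z : finType) (W' : DMC X Z) (W : DMC X Y) : Prop :=
  exists V : DMC Y Z, W' = comp_channel V W.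

Definition channel_equiv (X Y Z : finType) (W : DMC X Y) (W' : DMC X Z) :
  Prop := degraded W' W /\ degraded W W'.

Lemma is_channel_id (X : finType) :
  is_channel (fun xy : X * X => (xy.1 == xy.2)%:R : R).
Proof.
split=> [x y|x] /=; first by case: (x == y); rewrite ?lexx ler01.
by rewrite (bigD1 x) //= eqxx big1 ?addr0 // => y /negPf; rewrite eq_sym => ->.
Qed.

Lemma degraded_refl (X Y : finType) (W : DMC X Y) : degraded W W.
Proof.
exists (mk_channel (is_channel_id Y)); apply: channel_ext => x y.
rewrite {2}/channel_fun /= /comp_fun /= (bigD1 y) //= big1 ?addr0.
  by rewrite {2}/channel_fun /= eqxx mul1r.
by move=> z /negPf zy; rewrite {1}/channel_fun /= zy mul0r.
Qed.

Lemma degraded_trans (X Y Z T : finType)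
  (W : DMC X Y) (W' : DMC X Z) (W'' : DMC X T) :
  degraded W' W -> degraded W'' W' -> degraded W'' W.
Proof.
move=> [V ->] [U ->]; exists (comp_channel U V); apply: channel_ext => x t.
rewrite /channel_fun /= /comp_fun /=.
under eq_bigr do rewrite {2}/channel_fun /= /comp_fun /= mulr_sumr.
rewrite exchange_big /=; apply: eq_bigr => y _.
rewrite {3}/channel_fun /= /comp_fun /= mulr_suml.
by apply: eq_bigr => z _; rewrite mulrA.
Qed.

(* The output alphabets [n] for n >= 1 are represented by ['I_n.+1] for n >= 0;
   the topology on the sigma type is the disjoint union topology. *)
Definition DMC_union (X : finType) : Type := {n : nat & DMC X 'I_n.+1}.

HB.instance Definition _ (X : finType) :=
  Topological.copy (DMC_union X) {n : nat & DMC X 'I_n.+1}.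

Definition equiv_union (X : finType) (W W' : DMC_union X) : bool :=
  `[< channel_equiv (projT2 W) (projT2 W') >].

Lemma equiv_union_refl (X : finType) : reflexive (@equiv_union X).
Proof. by move=> W; apply/asboolP; split; exact: degraded_refl. Qed.

Lemma equiv_union_sym (X : finType) : symmetric (@equiv_union X).
Proof. by move=> W W'; apply/asboolP/asboolP => -[]. Qed.

Lemma equiv_union_trans (X : finType) : transitive (@equiv_union X).
Proof.
move=> W2 W1 W3 /asboolP[h12 h21] /asboolP[h23 h32]; apply/asboolP.
by split; [exact: degraded_trans h12 h23|exact: degraded_trans h32 h21].
Qed.

Definition channel_equiv_rel (X : finType) : equiv_rel (DMC_union X) :=
  EquivRel (@equiv_union X) (@equiv_union_refl X) (@equiv_union_sym X)
    (@equiv_union_trans X).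

(* The topology carried by [quotient_topology] is the strong topology. *)
Definition DMCo (X : finType) : Type :=
  quotient_topology {eq_quot (channel_equiv_rel X)}.

HB.instance Definition _ (X : finType) := Topological.copy (DMCo X)
  (quotient_topology {eq_quot (channel_equiv_rel X)}).
HB.instance Definition _ (X : finType) := Quotient.copy (DMCo X)
  (quotient_topology {eq_quot (channel_equiv_rel X)}).

End channels.

Arguments DMC : clear implicits.
Arguments DMC_union : clear implicits.
Arguments DMCo : clear implicits.

Definition compactly_generated (T : topologicalType) : Prop :=
  hausdorff_space T /\
  forall F : set T, closed F <-> forall K : set T, compact K -> closed (F `&` K).

Definition sequentially_open (T : topologicalType) (U : set T) : Prop :=
  forall (u : nat -> T) (x : T), U x -> u @ \oo --> x ->
    \forall n \near \oo, U (u n).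

Definition sequential_space (T : topologicalType) : Prop :=
  forall U : set T, sequentially_open U -> open U.

(* [normal_space] does not include the T1 axiom. *)
Definition T4_space (T : topologicalType) : Prop :=
  accessible_space T /\ normal_space T.

(* Main.v *)
Require Import Defs.
From HB Require Import structures.
From mathcomp Require Import all_boot all_order all_algebra.
From mathcomp Require Import all_classical all_reals topology normedtype.
From mathcomp Require Import generic_quotient interval_inference.

(* The quotient carries the final topology for the class maps
   [p_n : DMC_{X,[n]} -> DMC_{X,*}^(o)], whose sources are compact Hausdorff
   with the topology of coordinatewise convergence; this yields sequentiality
   and, once the quotient is Hausdorff, compact generation. Each [p_n] is
   closed: being equivalent to a channel of a given closed set is the projection
   of a closed condition involving the two degrading channels, which range over
   compact spaces. For normality, disjoint closed sets [A], [B] are enlarged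
   step by step to disjoint closed sets; the step for [n] adds the image under
   [p_n] of a closed neighbourhood of [p_n^-1 A] (resp. [p_n^-1 B]). As every
   [n] is treated infinitely often, the unions of the two increasing sequences
   have open preimages under all [p_n]. *)

Set Implicit Arguments.
Unset Strict Implicit.
Unset Printing Implicit Defensive.

Import Order.TTheory GRing.Theory Num.Theory.
Import numFieldNormedType.Exports.

Local Open Scope classical_set_scope.
Local Open Scope ring_scope.

(** * Properties inherited by final topologies *)

Lemma sequential_final (I : Type) (T : I -> topologicalType)
    (Q : topologicalType) (p : forall i, T i -> Q) :
  (forall i, continuous (p i)) ->
  (forall U, (forall i, open (p i @^-1` U)) -> open U) ->
  (forall i, sequential_space (T i)) -> sequential_space Q.
Proof.
move=> pcont pfinal seqT U seqU; apply: pfinal => i; apply: seqT => u x Ux ux.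
apply: (seqU (p i \o u) _ Ux); apply: cvg_comp ux _; exact: pcont.
Qed.

Section normal_union.
Context {R : realType} (T : nat -> topologicalType) (Q : topologicalType).
Variable p : forall n, T n -> Q.
Arguments p : clear implicits.
Hypothesis pcont : forall n, continuous (p n).
Hypothesis pclosed : forall n A, closed A -> closed (p n @` A).
Hypothesis pfinal : forall U, (forall n, open (p n @^-1` U)) -> open U.
Hypothesis normalT : forall n, normal_space (T n).

(** Normality of [T n] gives an open [G] around the preimage of [A] whose closure stays in the
    preimage of [O]; as [p n] is a closed map, the image of [closure G] can be added to [A]. *)
Lemma closed_thicken n (A O : set Q) : closed A -> open O -> A `<=` O ->
  exists A1, [/\ closed A1, A `<=` A1, A1 `<=` O &
    p n @^-1` A `<=` (p n @^-1` A1)°].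
Proof.
move=> cA oO AO.
have cpA : closed (p n @^-1` A).
  by apply: preimage_closed => // x _; exact: pcont.
have [V /set_nbhsP[G [oG AG GV]] VO] :
    filter_from (set_nbhs (p n @^-1` A)) closure (p n @^-1` O).
  apply: normalT => //; apply/set_nbhsP; exists (p n @^-1` O); split => //.
  - by apply: open_comp => // x _; exact: pcont.
  - exact: preimage_subset.
exists (A `|` p n @` closure G); split.
- by apply: closedU => //; apply/pclosed/closed_closure.
- by left.
- move=> _ [/AO//|[x Gx <-]]; apply: VO; exact: closureS Gx.
- move=> x /AG Gx; rewrite /interior nbhsE; exists G => // y Gy.
  by right; exists y => //; exact: subset_closure.
Qed.

Definition closed_disjoint (S : set Q * set Q) :=
  [/\ closed S.1, closed S.2 & S.1 `&` S.2 = set0].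

Lemma closed_disjoint_thicken n S : closed_disjoint S ->
  exists S1, [/\ closed_disjoint S1, S.1 `<=` S1.1, S.2 `<=` S1.2,
    p n @^-1` S.1 `<=` (p n @^-1` S1.1)° &
    p n @^-1` S.2 `<=` (p n @^-1` S1.2)°].
Proof.
case: S => A B [/= cA cB /disjoints_subset AB].
have [A1 [cA1 AA1 A1B pA]] := closed_thicken n cA (closed_openC cB) AB.
(* [B] is thickened inside the complement of the already enlarged [A1], which keeps the two sets
   disjoint. *)
have [B1 [cB1 BB1 B1A pB]] :=
  closed_thicken n cB (closed_openC cA1) (subsetCr A1B).
exists (A1, B1); split => //; split => //=.
by rewrite setIC; exact/disjoints_subset.
Qed.

(* Each index [n] is treated at infinitely many stages [k], namely those with
   [logn 2 k.+1 = n]. *)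
Lemma normal_final : normal_space Q.
Proof.
apply/(@normal_openP R) => A B cA cB AB0.
(* Disjointness is a premise inside the existential so that [f] is total; on other pairs its value
   is irrelevant. *)
have /choice[f fP] : forall nS : nat * (set Q * set Q), exists S1,
    closed_disjoint nS.2 ->
    [/\ closed_disjoint S1, nS.2.1 `<=` S1.1, nS.2.2 `<=` S1.2,
      p nS.1 @^-1` nS.2.1 `<=` (p nS.1 @^-1` S1.1)° &
      p nS.1 @^-1` nS.2.2 `<=` (p nS.1 @^-1` S1.2)°].
  move=> [n S]; have [dS|ndS] := pselect (closed_disjoint S); last by exists S.
  by have [S1 S1P] := closed_disjoint_thicken n dS; exists S1.
pose idx k := logn 2 k.+1.
pose S := fix S k := if k is k'.+1 then f (idx k', S k') else (A, B).
have SP k : closed_disjoint (S k).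
  by elim: k => [//|k IH]; case: (fP (idx k, S k) IH).
have S1mono : {homo (fun k => (S k).1) : k l / (k <= l)%N >-> k `<=` l}.
  apply: homo_leq => [X//|Y X Z|k]; first exact: subset_trans.
  by case: (fP (idx k, S k) (SP k)).
have S2mono : {homo (fun k => (S k).2) : k l / (k <= l)%N >-> k `<=` l}.
  apply: homo_leq => [X//|Y X Z|k]; first exact: subset_trans.
  by case: (fP (idx k, S k) (SP k)).
have later n k : exists2 l, (k <= l)%N & idx l = n.
  (* Here [l.+1] is [2 ^ n] times an odd number exceeding [k], so its 2-adic valuation is [n]. *)
  exists (2 ^ n * (2 * k).+1).-1%N.
    rewrite -ltnS prednK ?muln_gt0 ?expn_gt0//.
    by apply: leq_trans (leq_pmull _ _); rewrite ?expn_gt0// ltnS leq_pmull.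
  rewrite /idx prednK ?muln_gt0 ?expn_gt0// lognM ?expn_gt0// pfactorK//.
  by rewrite lognE /= dvdn2 /= oddM addn0.
exists (\bigcup_k (S k).1), (\bigcup_k (S k).2); split.
(* A point of stage [k] survives to a stage [l >= k] that treats [n]; the preimage of stage [l.+1]
   under [p n] is then a neighbourhood of it. *)
- apply: pfinal => n; rewrite openE => x [k _ Skx].
  have [l kl ln] := later n k.
  have [_ _ _ + _] := fP (idx l, S l) (SP l); rewrite ln => /(_ x).
  move=> /(_ (S1mono _ _ kl _ Skx)); apply: filterS => y; exists l.+1 => //.
  by rewrite /= ln.
- apply: pfinal => n; rewrite openE => x [k _ Skx].
  have [l kl ln] := later n k.
  have [_ _ _ _] := fP (idx l, S l) (SP l); rewrite ln => /(_ x).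
  move=> /(_ (S2mono _ _ kl _ Skx)); apply: filterS => y; exists l.+1 => //.
  by rewrite /= ln.
- by move=> x Ax; exists 0.
- by move=> x Bx; exists 0.
(* A common point would already lie in both sets of stage [maxn k l]. *)
- rewrite -subset0 => x [[k _ Skx] [l _ Slx]].
  have [_ _ <-] := SP (maxn k l); split.
    exact: S1mono (leq_maxl k l) _ Skx.
  exact: S2mono (leq_maxr k l) _ Slx.
Qed.

End normal_union.

(** Each singleton of [Q] is the image of a closed singleton under a closed map. *)
Lemma accessible_final (I : Type) (T : I -> topologicalType)
    (Q : topologicalType) (p : forall i, T i -> Q) :
  (forall i A, closed A -> closed (p i @` A)) ->
  (forall i, accessible_space (T i)) ->
  (forall q, exists i x, p i x = q) -> accessible_space Q.
Proof.
move=> pclosed T1 psurj x y xy; exists (~` [set y]); rewrite !inE/=; split.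
- have [i [z <-]] := psurj y; rewrite openC -image_set1.
  exact/pclosed/accessible_closed_set1.
- exact/eqP.
- exact.
Qed.

Lemma T4_hausdorff (R : realType) (Q : topologicalType) :
  T4_space Q -> hausdorff_space Q.
Proof.
move=> [T1 /(@normal_openP R) nQ]; rewrite open_hausdorff => x y /eqP xy.
have closed1 := accessible_closed_set1 T1.
have [|U [V [oU oV xU yV UV0]]] := nQ _ _ (closed1 x) (closed1 y).
  by rewrite -subset0 => _ [-> /xy].
by exists (U, V); split; rewrite ?inE ?UV0//=; [exact: xU|exact: yV].
Qed.

Lemma compactly_generated_final (I : Type) (T : I -> topologicalType)
    (Q : topologicalType) (p : forall i, T i -> Q) :
  (forall i, continuous (p i)) ->
  (forall U, (forall i, open (p i @^-1` U)) -> open U) ->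
  (forall i, compact [set: T i]) ->
  hausdorff_space Q -> compactly_generated Q.
Proof.
move=> pcont pfinal cptT T2; split => // F; split=> [cF K cK|Fk].
  by apply: closedI => //; exact: compact_closed.
rewrite -openC; apply: pfinal => i; rewrite preimage_setC openC.
(* [range (p i)] is compact, and intersecting [F] with it does not change the preimage under
   [p i]. *)
rewrite [X in closed X](_ : _ = p i @^-1` (F `&` range (p i))); last first.
  by apply/seteqP; split=> [x Fx|x []//]; split => //; exists x.
apply: preimage_closed => [x _|]; first exact: pcont.
apply: Fk; apply: continuous_compact (cptT i).
exact: continuous_subspaceT.
Qed.

(** * Channels with a fixed output alphabet *)

Lemma sum_continuous (R : realType) (T : topologicalType) (I : finType)
    (f : I -> T -> R) :
  (forall i, continuous (f i)) -> continuous (fun t => \sum_i f i t).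
Proof.
move=> fcont.
exact: (@continuous_big R I +%R 0 xpredT (@add_continuous R) T _ _
  (fun i _ => fcont i)).
Qed.

Section DMC_topology.
Context {R : realType}.
Implicit Types X Y Z : finType.

Lemma DMC_eval_continuous X Y (xy : X * Y) :
  continuous (fun W : DMC R X Y => W xy).
Proof.
move=> W; apply: (@continuous_comp _ {ptws (X * Y)%type -> R} _
  (@channel_fun R X Y) (@proj _ (fun=> R) xy)).
  exact: initial_continuous.
exact: (@proj_continuous _ (fun=> R)).
Qed.

Lemma DMC_cvg X Y (F : set_system (DMC R X Y)) (W : DMC R X Y) : Filter F ->
  (forall xy, V xy @[V --> F] --> W xy) -> F --> W.
Proof.
move=> FF FW U [_ [[V oV <-] VW VU]].
apply: filterS VU _ => /=.
suff : (fun W => W : {ptws (X * Y)%type -> R}) @ F -->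
    (W : {ptws (X * Y)%type -> R}).
  by apply; exact: open_nbhs_nbhs.
apply/cvg_sup => xy A [_ [[B oB <-] BW BA]].
apply: filterS BA _; apply: (FW xy); exact: open_nbhs_nbhs.
Qed.

(** If [U] is not a neighbourhood of [W], channels outside [U] within [1/(n+1)] of [W] in every
    coordinate form a sequence converging to [W]. Finiteness of [X * Y] makes these coordinate
    conditions a neighbourhood. *)
Lemma DMC_sequential X Y : sequential_space (DMC R X Y).
Proof.
move=> U seqU; rewrite openE.
suff nearU (W : DMC R X Y) : U W -> nbhs W U by [].
move=> UW; apply: contrapT => nU.
have /choice[u uP] : forall n : nat, exists V : DMC R X Y,
    (forall xy, `|W xy - V xy| < n.+1%:R^-1) /\ ~ U V.
  move=> n; apply: contrapT => /forallNP noV; apply: nU.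
  have : \forall V \near W, forall xy, `|W xy - channel_fun V xy| < n.+1%:R^-1.
    apply: (@filter_forall _ _ _ (nbhs W) (nbhs_filter W)) => xy.
    have /cvgrPdist_lt := @DMC_eval_continuous X Y xy W.
    by apply; rewrite invr_gt0.
  by apply: filterS => V WV; apply: contrapT => UV; exact: (noV V).
have /(seqU _ _ UW)[N _ /(_ N (leqnn N))] : u @ \oo --> W; last first.
  by case: (uP N).
apply: DMC_cvg => xy; suff : u n xy @[n --> \oo] --> W xy by [].
apply/cvgrPdist_lt => e e0; near=> n; apply: (lt_trans ((uP n).1 xy)).
by near: n; exact: (near_infty_natSinv_lt (PosNum e0)).
Unshelve. all: by end_near. Qed.

Lemma DMC_continuous (T : topologicalType) X Y (f : T -> DMC R X Y) :
  (forall xy, continuous (fun t => f t xy)) -> continuous f.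
Proof. by move=> fcont t; apply: DMC_cvg => xy; exact: fcont. Qed.

Lemma DMC_hausdorff X Y : hausdorff_space (DMC R X Y).
Proof.
move=> W W' cl; apply: channel_ext => x y; apply: Rhausdorff => A B nA nB.
have [V [AV BV]] := cl _ _ (@DMC_eval_continuous X Y (x, y) W A nA)
  (@DMC_eval_continuous X Y (x, y) W' B nB).
by exists (channel_fun V (x, y)).
Qed.

Lemma is_channel_closed X Y :
  closed [set W : {ptws (X * Y)%type -> R} | is_channel W].
Proof.
have pc (xy : X * Y) : continuous (fun W : {ptws (X * Y)%type -> R} => W xy).
  exact: (@proj_continuous _ (fun=> R)).
rewrite [X in closed X](_ : _ =
  (\bigcap_(xy : X * Y) [set W | W xy \in `[0, 1]]) `&`
  (\bigcap_x [set W : {ptws (X * Y)%type -> R} | \sum_y W (x, y) = 1]));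
  last first.
  apply/seteqP; split=> W.
    move=> [W01 W1]; split=> [[x y] _|x _] /=; last exact: W1.
    by rewrite in_itv/=; exact: W01.
  move=> [W01 W1]; split=> [x y|x]; last exact: W1.
  by have := W01 (x, y) Logic.I; rewrite /= in_itv.
apply: closedI; apply: closed_bigI => i _.
  apply: (@preimage_closed _ _ (fun W : {ptws (X * Y)%type -> R} => W i)
    `[0, 1]%classic).
    by move=> W _; exact: pc.
  exact: interval_closed.
apply: (@preimage_closed _ _
  (fun W : {ptws (X * Y)%type -> R} => \sum_y W (i, y)) [set 1]).
  by move=> W _; apply: sum_continuous => y; exact: pc.
exact: closed_eq.
Qed.

Lemma DMC_compact X Y : compact [set: DMC R X Y].
Proof.
have /subclosed_compact channels_compact := @is_channel_closed X Y.
have cA : compact [set W : {ptws (X * Y)%type -> R} | is_channel W].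
  apply: channels_compact.
    exact: (@tychonoff (X * Y)%type (fun=> R) (fun=> `[0, 1]%classic)
      (fun=> @segment_compact R 0 1)).
  by move=> W [W01 _] [x y] /=; rewrite in_itv/=; exact: W01.
(* Compactness passes from the set of functions to the subspace type: the filter is pushed forward,
   and a cluster point, being a channel, is lifted back. *)
move=> F FF _.
have valF : ((@channel_fun R X Y : _ -> {ptws (X * Y)%type -> R}) @ F)
    [set W | is_channel W].
  suff : F (@channel_fun R X Y @^-1` [set W | is_channel W]) by [].
  by apply: (@filterS _ F _ setT) filterT => V _; exact: channelP.
have [W [hW clW]] := cA _ _ valF.
exists (mk_channel hW); split => // A B FA [_ [[O oO <-] OW OB]].
have FA' : F (@channel_fun R X Y @^-1` (@channel_fun R X Y @` A)).
  exact: filterS (@preimage_image _ _ (@channel_fun R X Y) A) FA.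
have [_ [[V AV <-] OV]] := clW _ O FA' (open_nbhs_nbhs (conj oO OW)).
by exists V; split => //; exact: OB.
Qed.

Lemma comp_channel_continuous X Y Z :
  continuous (fun VW : DMC R Y Z * DMC R X Y => comp_channel VW.1 VW.2).
Proof.
apply: DMC_continuous => xz; rewrite /channel_fun /= /comp_fun.
apply: sum_continuous => y VW; apply: cvgM.
  apply: (@continuous_comp _ _ _ fst (fun V : DMC R Y Z => V (y, xz.2))).
    exact: cvg_fst.
  exact: DMC_eval_continuous.
apply: (@continuous_comp _ _ _ snd (fun W : DMC R X Y => W (xz.1, y))).
  exact: cvg_snd.
exact: DMC_eval_continuous.
Qed.

(* Equivalent channels are mutual compositions, so the saturation of [C] is the
   image of a closed set of triples [(V, W, V')] under [V \o W]. *)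
Lemma closed_equiv_channels X Y Z (C : set (DMC R X Y)) : closed C ->
  closed [set W' : DMC R X Z | exists2 W, C W & channel_equiv W W'].
Proof.
move=> cC.
pose P := (DMC R Y Z * DMC R X Y * DMC R Z Y)%type.
pose f (t : P) : DMC R X Z := comp_channel t.1.1 t.1.2.
pose g (t : P) : DMC R X Y := comp_channel t.2 (f t).
have fst_cont : continuous (fun t : P => t.1) by move=> t; exact: cvg_fst.
have snd_cont : continuous (fun t : P => t.2) by move=> t; exact: cvg_snd.
have fcont : continuous f.
  move=> t.
  exact: continuous_comp (fst_cont t) (@comp_channel_continuous X Y Z _).
have W_cont : continuous (fun t : P => t.1.2).
  move=> t; apply: (continuous_comp (fst_cont t)); exact: cvg_snd.
have gcont : continuous g.
  move=> t; apply: (@continuous_comp _ _ _ (fun t : P => (t.2, f t))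
    (fun VW => comp_channel VW.1 VW.2)).
    exact: (@cvg_pair _ _ _ (nbhs t) (nbhs t.2) (nbhs (f t)) _ _ _ _ _
      (snd_cont t) (fcont t)).
  exact: (@comp_channel_continuous X Z Y).
(* The equation [g t = t.1.2] says that the third channel of the triple recovers [W] from [f t];
   coordinatewise it is a closed condition on reals. *)
pose K := (fun t : P => t.1.2) @^-1` C `&`
  \bigcap_(xy : X * Y) [set t : P | g t xy - t.1.2 xy = 0].
have cK : closed K.
  apply: closedI; first by apply: preimage_closed => // t _; exact: W_cont.
  apply: closed_bigI => xy _.
  apply: (@preimage_closed _ _ (fun t : P => g t xy - t.1.2 xy) [set 0]).
    move=> t _; apply: cvgB.
      exact: continuous_comp (gcont t) (@DMC_eval_continuous X Y xy (g t)).
    exact: continuous_comp (W_cont t) (@DMC_eval_continuous X Y xy t.1.2).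
  exact: closed_eq.
have Kcompact : compact K.
  apply: subclosed_compact cK _ _.
    apply: compact_setX (@DMC_compact Z Y).
    apply: compact_setX; exact: DMC_compact.
  by [].
rewrite [X in closed X](_ : _ = f @` K); last first.
  apply/seteqP; split=> [W' [W CW [[V W'E] [V' WE]]]|_ [t [Ct gt] <-]].
    exists (V, W, V') => //; split => // xy _.
    by rewrite /= /g /f /= -W'E -WE subrr.
  exists t.1.2 => //; split; first by exists t.1.1.
  exists t.2; apply: channel_ext => x y.
  by apply/esym/eqP; rewrite -subr_eq0; apply/eqP; exact: gt (x, y) _.
apply: compact_closed; first exact: DMC_hausdorff.
by apply: continuous_compact Kcompact; exact: continuous_subspaceT.
Qed.

End DMC_topology.

(** * The quotient by channel equivalence *)

Section strong_topology.
Context {R : realType} (X : finType).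

Definition DMCo_class n (W : DMC R X 'I_n.+1) : DMCo R X :=
  (\pi_(DMCo R X) (existT _ n W : DMC_union R X))%qT.

Lemma DMCo_classP n m (W : DMC R X 'I_n.+1) (W' : DMC R X 'I_m.+1) :
  DMCo_class W = DMCo_class W' <-> channel_equiv W W'.
Proof.
rewrite /DMCo_class; split=> [/eqmodP/asboolP//|WW'].
by apply/eqmodP/asboolP.
Qed.

Lemma DMCo_class_surj (q : DMCo R X) : exists n (W : DMC R X 'I_n.+1),
  DMCo_class W = q.
Proof.
by case: (repr q) (reprK q) => n W <-; exists n, W.
Qed.

(** Openness in the quotient unfolds to openness of the preimage in the disjoint union, which is
    tested on each summand. *)
Lemma DMCo_openP (U : set (DMCo R X)) :
  open U <-> forall n, open (@DMCo_class n @^-1` U).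
Proof. exact: (@sigT_openP _ (fun n => DMC R X 'I_n.+1)). Qed.

Lemma DMCo_class_continuous n : continuous (@DMCo_class n).
Proof. by apply/continuousP => U /DMCo_openP. Qed.

Lemma DMCo_class_closed n (A : set (DMC R X 'I_n.+1)) :
  closed A -> closed (@DMCo_class n @` A).
Proof.
move=> cA; rewrite -openC; apply/DMCo_openP => m.
rewrite preimage_setC openC.
rewrite [X in closed X](_ : _ =
  [set W' | exists2 W, A W & channel_equiv W W']); last first.
  apply/seteqP; split=> W' [W AW].
    by move/DMCo_classP; exists W.
  by move/DMCo_classP; exists W.
exact: closed_equiv_channels.
Qed.

End strong_topology.

Theorem theorem4 (R : realType) (X : finType) (hX : (0 < #|X|)%N) :
  [/\ compactly_generated (DMCo R X), sequential_space (DMCo R X)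
    & T4_space (DMCo R X)].
Proof.
have pcont := @DMCo_class_continuous R X.
have pclosed := @DMCo_class_closed R X.
have pfinal U := (@DMCo_openP R X U).2.
have T4 : T4_space (DMCo R X).
  split.
    apply: accessible_final pclosed _ (@DMCo_class_surj R X) => n.
    exact/hausdorff_accessible/DMC_hausdorff.
  apply: (normal_final (R := R) pcont pclosed pfinal) => n.
  apply: compact_normal; [exact: DMC_hausdorff|exact: DMC_compact].
split=> //.
  apply: compactly_generated_final pcont pfinal _ (T4_hausdorff R T4) => n.
  exact: DMC_compact.
by apply: sequential_final pcont pfinal _ => n; exact: DMC_sequential.
Qed.
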